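(* Let $A$ be a non-zero positive bounded operator on a complex Hilbert space $\mathscr{H}$ and let $B,C\in\mathbb{B}_A(\mathscr{H})$. Then $$\frac18\|B+C\|_A^4\le w_{A,e}(B^\sharp B,C^\sharp C)\,w_{A,e}(BB^\sharp,CC^\sharp).$$
   Context: $\mathbb{B}(\mathscr{H})$ is the algebra of bounded linear operators on $\mathscr{H}$. For $x,y\in\mathscr{H}$, $\langle x,y\rangle_A=\langle Ax,y\rangle$ and $\|x\|_A=\langle Ax,x\rangle^{1/2}$. $\mathbb{B}_A(\mathscr{H})$ is the set of $T\in\mathbb{B}(\mathscr{H})$ for which there is $S\in\mathbb{B}(\mathscr{H})$ with $AS=T^*A$. For $T\in\mathbb{B}_A(\mathscr{H})$, $T^\sharp$ is the unique solution $X\in\mathbb{B}(\mathscr{H})$ of $AX=T^*A$ whose range is contained in $\overline{\mathcal{R}(A)}$. The $A$-operator seminorm is $\|T\|_A=\sup\{\|Tx\|_A:\|x\|_A=1\}$ (finite for $T\in\mathbb{B}_A(\mathscr{H})$). The $A$-Euclidean operator radius of a pair is $w_{A,e}(S,T)=\sup\{(|\langle Sx,x\rangle_A|^2+|\langle Tx,x\rangle_A|^2)^{1/2}: \|x\|_A=1\}$. *)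

(* Defs.v *)
From HB Require Import structures.
From mathcomp Require Import all_boot all_order all_algebra.
From mathcomp Require Import all_classical all_reals all_analysis.
From mathcomp Require Import complex.

Set Implicit Arguments.
Unset Strict Implicit.
Unset Printing Implicit Defensive.

Import Order.TTheory GRing.Theory Num.Theory.
Import numFieldNormedType.Exports.

Local Open Scope classical_set_scope.
Local Open Scope ring_scope.

(* A complex Hilbert space is a complete normed module [H] over [R[i]] together
   with a form [dot : {dot H for Num.conj}], linear in its first argument and
   conjugate-linear in its second, such that [hilbert_norm dot] holds. *)

Section HilbertOperators.
Context {R : realType} {H : completeNormedModType R[i]}.
Variable dot : {dot H for Num.conj}.

Definition hilbert_norm : Prop := forall x : H, `|x| ^+ 2 = dot x x.

Definition bounded_op (T : H -> H) : Prop :=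
  linear T /\ exists M : R[i], forall x, `|T x| <= M * `|x|.

(* In [R[i]], [0 <= z] says that [z] is real and nonnegative. *)
Definition positive_op (T : H -> H) : Prop := forall x, 0 <= dot (T x) x.

Definition is_adjoint (T S : H -> H) : Prop :=
  forall x y, dot (T x) y = dot x (S y).

Definition adjoint (T : H -> H) : H -> H :=
  xget (cst 0) [set S | bounded_op S /\ is_adjoint T S].

Variable A : H -> H.

Definition dotA (x y : H) : R[i] := dot (A x) y.

(* [dotA x x] is real and nonnegative when [A] is positive, so taking its real
   part only changes its type from [R[i]] to [R]. *)
Definition normA (x : H) : R := Num.sqrt (complex.Re (dotA x x)).

Definition BA : set (H -> H) :=
  [set T | bounded_op T /\
     exists S : H -> H, bounded_op S /\ A \o S = adjoint T \o A].

Definition is_sharp (T X : H -> H) : Prop :=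
  [/\ bounded_op X, A \o X = adjoint T \o A
    & range X `<=` closure (range A)].

Definition sharp (T : H -> H) : H -> H := xget (cst 0) [set X | is_sharp T X].

(* The suprema below are finite for operators in [BA], and are over nonempty
   sets when [A] is positive and non-zero. *)
Definition opnormA (T : H -> H) : R :=
  sup [set normA (T x) | x in [set x | normA x = 1]].

Definition wAe (S T : H -> H) : R :=
  sup [set Num.sqrt (ComplexField.Normc.normc (dotA (S x) x) ^+ 2 +
                   ComplexField.Normc.normc (dotA (T x) x) ^+ 2)
      | x in [set x | normA x = 1]].

End HilbertOperators.

(* Main.v *)
Require Import Defs.
From HB Require Import structures.
From mathcomp Require Import all_boot all_order all_algebra.
From mathcomp Require Import all_classical all_reals all_analysis.
From mathcomp Require Import complex.
From mathcomp Require Import ring lra.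

(** Since [B] and [sharp B] are adjoint for the semi-inner product
    [<x, y>_A], the numbers [<B# B x, x>_A] and [<B B# x, x>_A] are [||B x||_A^2]
    and [||B# x||_A^2].  For [||x||_A = 1], convexity of the square gives
    [||B x + C x||_A^2 <= 2 (||B x||_A^2 + ||C x||_A^2) <= 2 sqrt 2 w(B# B, C# C)]
    and likewise for [B# + C#] with [w(B B#, C C#)]; as [B + C] and [B# + C#]
    have the same [A]-seminorm, multiplying the two bounds gives the result.

    The existence of adjoints and of [sharp B] (the projection onto the closure
    of the range of [A], composed with any solution of [A S = B* A]) both come
    from one form of the Riesz theorem, proved by minimising
    [|u|^2 - 2 Re (f u)] over a subspace.  That the suprema are finite is Krein's
    argument: if [T] is [A]-selfadjoint, then [||T^n x||_A^2] is log-convex in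
    [n] and grows at most like [||T||^(2n)]. *)

Set Implicit Arguments.
Unset Strict Implicit.
Unset Printing Implicit Defensive.

Import Order.TTheory GRing.Theory Num.Theory.
Import numFieldNormedType.Exports.

Local Open Scope classical_set_scope.
Local Open Scope ring_scope.

Local Notation Re := complex.Re.
Local Notation normc := ComplexField.Normc.normc.

(** * Real parts and moduli in [R[i]] *)

Section ComplexNumbers.
Context {R : realType}.
Implicit Types z w : R[i].

Lemma ReD z w : Re (z + w) = Re z + Re w.
Proof. by case: z w => [? ?] [? ?]. Qed.

Lemma ReN z : Re (- z) = - Re z.
Proof. by case: z. Qed.

Lemma ReZ (a : R) z : Re (a%:C%C * z) = a * Re z.
Proof. by case: z => x y /=; rewrite mul0r subr0. Qed.

Lemma Re_conj z : Re (Num.conj z) = Re z.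
Proof. by case: z. Qed.

Lemma ge0_RRe z : 0 <= z -> z = (Re z)%:C%C.
Proof. by move=> z0; rewrite RRe_real// ger0_real. Qed.

Lemma RtoC_normc z : (normc z)%:C%C = `|z|.
Proof. by []. Qed.

Lemma normc_ge0 z : 0 <= normc z.
Proof. by rewrite -ler0c RtoC_normc. Qed.

Lemma Re_le_normc z : Re z <= normc z.
Proof.
have := normc_ge_Re z; rewrite -RtoC_normc lecR; exact/le_trans/ler_norm.
Qed.

Lemma normc_ge0_id z : 0 <= z -> normc z = Re z.
Proof. by move=> z0; apply: complexI; rewrite RtoC_normc ger0_norm// -ge0_RRe.
Qed.

Lemma conj_RtoC (a : R) : Num.conj a%:C%C = a%:C%C :> R[i].
Proof. exact: conjc_real. Qed.

Lemma Re_mul_conj z : Re (z * Num.conj z) = normc z ^+ 2.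
Proof.
rewrite -normCK; have -> : `|z| = (normc z)%:C%C by [].
by rewrite -rmorphXn.
Qed.

End ComplexNumbers.

(** * Positive semidefinite Hermitian forms *)

Section PositiveForms.
Context {R : realType} {V : lmodType R[i]}.

(** Stated for bare functions, so as to cover both [dot] and the possibly degenerate
    [dotA dot A]. *)
Definition positive_form (f : V -> V -> R[i]) : Prop :=
  [/\ forall a x y z, f (a *: x + y) z = a * f x z + f y z,
      forall x y, f x y = Num.conj (f y x)
    & forall x, 0 <= f x x].

Variable f : V -> V -> R[i].
Hypothesis fP : positive_form f.

Definition sqn (x : V) : R := Re (f x x).

Let fC x y : f x y = Num.conj (f y x). Proof. by case: fP. Qed.

Lemma pformDl x y z : f (x + y) z = f x z + f y z.
Proof. by case: fP => + _ _ => /(_ 1 x y z); rewrite scale1r mul1r. Qed.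

Lemma pform0l z : f 0 z = 0.
Proof. by apply: (addrI (f 0 z)); rewrite -pformDl !addr0. Qed.

Lemma pformZl a x z : f (a *: x) z = a * f x z.
Proof. by case: fP => + _ _ => /(_ a x 0 z); rewrite !addr0 pform0l addr0. Qed.

Lemma pformBl x y z : f (x - y) z = f x z - f y z.
Proof. by rewrite -scaleN1r pformDl pformZl mulN1r. Qed.

Lemma pformDr x y z : f z (x + y) = f z x + f z y.
Proof. by rewrite fC pformDl rmorphD /= -!fC. Qed.

Lemma pformZr a x z : f z (a *: x) = Num.conj a * f z x.
Proof. by rewrite fC pformZl rmorphM /= -!fC. Qed.

Lemma pformBr x y z : f z (x - y) = f z x - f z y.
Proof. by rewrite fC pformBl rmorphB /= -!fC. Qed.

Lemma sqnE x : f x x = (sqn x)%:C%C.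
Proof. by apply: ge0_RRe; case: fP. Qed.

Lemma sqn_ge0 x : 0 <= sqn x.
Proof. by rewrite -ler0c -sqnE; case: fP. Qed.

Lemma ReC x y : Re (f x y) = Re (f y x).
Proof. by rewrite fC Re_conj. Qed.

Lemma sqnD x y : sqn (x + y) = sqn x + sqn y + 2 * Re (f x y).
Proof.
rewrite /sqn pformDl !pformDr !ReD (ReC y x); ring.
Qed.

Lemma sqnZ a x : sqn (a *: x) = normc a ^+ 2 * sqn x.
Proof.
by rewrite /sqn pformZl pformZr mulrA sqnE mulrC ReZ Re_mul_conj mulrC.
Qed.

Lemma sqnZr (a : R) x : sqn (a%:C%C *: x) = a ^+ 2 * sqn x.
Proof. by rewrite sqnZ /= expr0n addr0 sqr_sqrtr// sqr_ge0. Qed.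

Lemma sqnN x : sqn (- x) = sqn x.
Proof.
rewrite -scaleN1r sqnZ /= !oppr0 expr0n addr0 sqr_sqrtr ?sqr_ge0//.
by rewrite sqrrN expr1n mul1r.
Qed.

Lemma sqnB x y : sqn (x - y) = sqn x + sqn y - 2 * Re (f x y).
Proof.
rewrite /sqn pformBl !pformBr !(ReD, ReN) (ReC y x); ring.
Qed.

(* Minimising [sqn (x + t y)] along [t = - s (f x y)] with [s] real. *)
Lemma sqn_shift x y (s : R) :
  0 <= sqn x - 2 * s * normc (f x y) ^+ 2 +
       s ^+ 2 * normc (f x y) ^+ 2 * sqn y.
Proof.
have := sqn_ge0 (x + (- (s%:C%C * f x y)) *: y).
rewrite sqnD scaleNr sqnN -scalerA sqnZr sqnZ -scaleNr pformZr.
rewrite -rmorphN pformZr.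
suff -> : Re (Num.conj (- s)%:C%C * (Num.conj (f x y) * f x y)) =
  - s * normc (f x y) ^+ 2 by move=> h; apply: (le_trans h); lra.
by rewrite conj_RtoC ReZ mulrC (mulrC (Num.conj _)) Re_mul_conj mulrC.
Qed.

Lemma form_CauchySchwarz x y : normc (f x y) ^+ 2 <= sqn x * sqn y.
Proof.
have := sqn_ge0 y; rewrite le_eqVlt => /predU1P[y0|y_gt0]; last first.
  (* This [s] minimises the quadratic of [sqn_shift]. *)
  have := sqn_shift x y (sqn y)^-1.
  rewrite -ler_pdivrMr// -[in X in _ -> X]subr_ge0.
  congr (is_true (0 <= _)); field; exact: lt0r_neq0.
(* Now the bound of [sqn_shift] is affine in [s]; the [s] chosen next would give it the value
   [- sqn x - 2]. *)
rewrite -y0 mulr0 leNgt; apply/negP => g_gt0.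
have := sqn_shift x y ((sqn x + 1) / normc (f x y) ^+ 2).
rewrite -y0 mulr0 addr0 -mulrA divfK ?lt0r_neq0//.
have := sqn_ge0 x; lra.
Qed.

Lemma normc_form_le x y :
  normc (f x y) <= Num.sqrt (sqn x) * Num.sqrt (sqn y).
Proof.
rewrite -sqrtrM ?sqn_ge0// -[leLHS]ger0_norm ?normc_ge0// -sqrtr_sqr.
by rewrite ler_wsqrtr// form_CauchySchwarz.
Qed.

(** Parallelogram identity, with the nonnegative term [sqn (x - y)] dropped. *)
Lemma sqnD_le x y : sqn (x + y) <= 2 * (sqn x + sqn y).
Proof. by have := sqn_ge0 (x - y); rewrite sqnB sqnD; lra. Qed.

End PositiveForms.

(** * The Riesz theorem on a subspace *)

Section Riesz.
Context {R : realType} {H : completeNormedModType R[i]}.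
Variable dot : {dot H for Num.conj}.
Hypothesis dotP : hilbert_norm dot.

Local Notation nsq := (sqn dot).

Lemma dot_form : positive_form dot.
Proof.
split=> [a x y z|x y|x]; last exact: dnorm_ge0.
  by rewrite linearPl.
by rewrite hermC expr0 mul1r.
Qed.

(** The norm of [H] takes values in [R[i]]; this is the same number in [R]. *)
Definition rnorm (x : H) : R := Re `|x|.

Lemma rnormE x : `|x| = (rnorm x)%:C%C.
Proof. exact: ge0_RRe. Qed.

Lemma rnorm_ge0 x : 0 <= rnorm x.
Proof. by rewrite -ler0c -rnormE. Qed.

Lemma sqr_rnorm x : rnorm x ^+ 2 = nsq x.
Proof.
by apply: complexI; rewrite rmorphXn/= -rnormE dotP (sqnE dot_form).
Qed.

Lemma sqrt_nsq x : Num.sqrt (nsq x) = rnorm x.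
Proof. by rewrite -sqr_rnorm sqrtr_sqr ger0_norm ?rnorm_ge0. Qed.

Lemma normc_dot_le x y : normc (dot x y) <= rnorm x * rnorm y.
Proof. by rewrite -!sqrt_nsq; exact: normc_form_le dot_form _ _. Qed.

Lemma bounded_opP (T : H -> H) : bounded_op T <->
  linear T /\ exists2 M : R, 0 < M & forall x, rnorm (T x) <= M * rnorm x.
Proof.
split=> -[Tlin] [M].
  move=> Mle; split => //; exists (normc M + 1).
    by rewrite ltr_wpDl// normc_ge0.
  move=> x; apply: (@le_trans _ _ (normc M * rnorm x)); last first.
    by rewrite ler_wpM2r ?rnorm_ge0// lerDl.
  rewrite -lecR rmorphM /= -!rnormE.
  have Mx0 : 0 <= M * `|x| by exact: le_trans (Mle x).
  by apply: le_trans (Mle x) _; rewrite -(ger0_norm Mx0) normrM normr_id.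
move=> M0 Mle; split => //; exists M%:C%C => x.
by rewrite !rnormE -rmorphM lecR.
Qed.

Lemma bounded_op_comp (S T : H -> H) :
  bounded_op S -> bounded_op T -> bounded_op (S \o T).
Proof.
move=> /bounded_opP[Sl [M M0 MS]] /bounded_opP[Tl [N N0 NT]].
apply/bounded_opP; split=> [a x y|]; first by rewrite /= Tl Sl.
exists (M * N) => [|x /=]; first exact: mulr_gt0.
by apply: le_trans (MS _) _; rewrite -mulrA ler_pM2l.
Qed.

Lemma dot_eqr x y : (forall z, dot z x = dot z y) -> x = y.
Proof.
move=> xy; apply/eqP; rewrite -subr_eq0 -(dnorm_eq0 dot); apply/eqP.
by rewrite (pformBr dot_form) xy subrr.
Qed.

Lemma closure_rnormP (K : set H) k : closure K k <->
  forall e : R, 0 < e -> exists2 u, K u & rnorm (k - u) < e.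
Proof.
split=> [Kk e e0|Kk U].
  have /Kk[u [Ku]] : nbhs k (ball k e%:C%C) by apply: nbhsx_ballx; rewrite ltcR.
  by rewrite -ball_normE /= rnormE ltcR; exists u.
rewrite -nbhs_ballE => -[e /= e0 kU].
have eE : e = (Re e)%:C%C by apply: ge0_RRe; exact: ltW.
have [|u Ku ku] := Kk (Re e); first by move: e0; rewrite eE ltcR.
exists u; split=> //; apply: kU.
by rewrite -ball_normE /= rnormE eE ltcR.
Qed.

Section Minimisation.
Variables (K : set H) (f : H -> R[i]).
Hypothesis K0 : K 0.
Hypothesis KP : forall a x y, K x -> K y -> K (a *: x + y).
Hypothesis fP : forall a x y, f (a *: x + y) = a * f x + f y.
Variable M : R.
Hypothesis fM : forall x, normc (f x) <= M * rnorm x.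

(** If [f] is [dot _ k], then [J u = nsq (u - k) - nsq k], so minimising [J] means approaching
    [k]. *)
Let J u := nsq u - 2 * Re (f u).

Let fD x y : f (x + y) = f x + f y.
Proof. by have := fP 1 x y; rewrite scale1r mul1r. Qed.

Let f0 : f 0 = 0.
Proof. by apply: (addrI (f 0)); rewrite -fD !addr0. Qed.

Let fZ a x : f (a *: x) = a * f x.
Proof. by have := fP a x 0; rewrite !addr0 f0 addr0. Qed.

Let fB x y : f (x - y) = f x - f y.
Proof. by rewrite -scaleN1r fD fZ mulN1r. Qed.

Let J_ge u : - M ^+ 2 <= J u.
Proof.
have := Re_le_normc (f u); have := fM u.
have := sqr_ge0 (rnorm u - M); rewrite /J -sqr_rnorm; nra.
Qed.

Let m := inf [set J u | u in K].

Let J_inf : has_inf [set J u | u in K].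
Proof.
split; first by exists (J 0), 0.
by exists (- M ^+ 2) => _ [u _ <-].
Qed.

Let m_le u : K u -> m <= J u.
Proof. by move=> Ku; apply: (ge_inf J_inf.2); exists u. Qed.

(** At the midpoint, [J] equals the mean of [J u] and [J v] minus a quarter of the squared distance,
    and it is still at least [m]. *)
Let minimizing_dist u v : K u -> K v ->
  rnorm (u - v) ^+ 2 <= 2 * (J u - m) + 2 * (J v - m).
Proof.
move=> Ku Kv; have Kw : K ((2^-1)%:C%C *: u + (2^-1)%:C%C *: v).
  by apply: KP => //; rewrite -[_ *: _]addr0; exact: KP.
have := m_le Kw; rewrite /J sqr_rnorm (sqnB dot_form) -scalerDr fZ fD.
rewrite (sqnZr dot_form) ReZ ReD (sqnD dot_form); lra.
Qed.

(* First-order optimality in the direction [v], up to the defect of [u]. *)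
Let minimizing_grad u v : K u -> K v ->
  normc (dot v u - f v) ^+ 2 <= (J u - m) * (1 + nsq v).
Proof.
move=> Ku Kv; set g := dot v u - f v; pose s := (1 + nsq v)^-1.
have v0 : 0 < 1 + nsq v by rewrite ltr_pwDl// -sqr_rnorm sqr_ge0.
(* A gradient step: [J (u - w) = J u - 2 s |g|^2 + s^2 |g|^2 nsq v], and this [s] makes the decrease
   at least [s |g|^2]. *)
pose w := s%:C%C *: (Num.conj g *: v).
have Kw : K (u - w).
  by rewrite addrC -scaleN1r !scalerA; exact: KP.
have := m_le Kw; rewrite /J (sqnB dot_form) fB /w !fZ ReD ReN.
rewrite (sqnZr dot_form) (sqnZ dot_form) (ReC dot_form) !(pformZl dot_form).
rewrite !ReZ.
have -> : normc (Num.conj g) = normc g.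
  by case: (g) => a b /=; rewrite sqrrN.
have -> : Re (Num.conj g * f v) = Re (Num.conj g * dot v u) - normc g ^+ 2.
  by rewrite -Re_mul_conj -ReN -ReD /g; congr Re; ring.
have sv : s * (1 + nsq v) = 1 by rewrite mulVf// lt0r_neq0.
have s0 : 0 < s by rewrite invr_gt0.
rewrite -ler_pdivrMr// -/s.
have -> : s ^+ 2 * (normc g ^+ 2 * nsq v) =
  s * normc g ^+ 2 * (s * (1 + nsq v)) - s ^+ 2 * normc g ^+ 2 by ring.
rewrite sv; have := mulr_ge0 (sqr_ge0 s) (sqr_ge0 (normc g)); lra.
Qed.

Let u_ex n : {u | K u /\ J u < m + n.+1%:R^-1}.
Proof.
apply: cid; have [|_ [u Ku <-] Ju] := inf_adherent _ J_inf (eps := n.+1%:R^-1).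
  by rewrite invr_gt0.
by exists u.
Qed.

Let u n := sval (u_ex n).

Let Ku n : K (u n). Proof. by case: (svalP (u_ex n)). Qed.

Let Ju n : J (u n) - m < n.+1%:R^-1.
Proof. by rewrite ltrBlDl; case: (svalP (u_ex n)). Qed.

Let u_cauchy (e : R) : 0 < e ->
  exists N, forall n, (N <= n)%N -> rnorm (u N - u n) < e.
Proof.
(* Two defects below [e ^+ 2 / 4] give a squared distance below [e ^+ 2] in [minimizing_dist]. *)
move=> e0; have e4 : 0 < e ^+ 2 / 4 by rewrite divr_gt0 ?exprn_gt0.
have [N _ NP] := near_infty_natSinv_lt (PosNum e4).
exists N => n Nn; rewrite -ltr_sqr ?nnegrE ?rnorm_ge0 ?ltW//.
have uN := lt_trans (Ju N) (NP N (leqnn N)).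
have un := lt_trans (Ju n) (NP n Nn).
have := minimizing_dist (Ku N) (Ku n); move: uN un => /=.
move: (J (u N) - m) (J (u n) - m) (rnorm _ ^+ 2) => a b c; lra.
Qed.

Let u_cvg : exists k, forall e : R, 0 < e ->
  exists N, forall n, (N <= n)%N -> rnorm (k - u n) < e.
Proof.
have /cauchy_cvgP uk : cauchy (u @ \oo).
  apply: cauchy_exP => e e0; have eE := ge0_RRe (ltW e0).
  have [|N NP] := u_cauchy (e := Re e); first by move: e0; rewrite eE ltcR.
  exists (u N); exists N => // n /= /NP; rewrite -ball_normE /= rnormE eE ltcR.
  by [].
have [k uk'] := (cvg_ex _).1 uk; exists k => e e0.
have /cvgrPdist_lt/(_ e%:C%C) := uk'.
rewrite ltcR => /(_ e0)[N _ NP]; exists N => n /NP.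
by rewrite /= rnormE ltcR.
Qed.

(** [k] is the limit of the minimising sequence, along which the defect [dot v (u n) - f v] tends to
    0 by [minimizing_grad]. Taking [K] to be the whole space yields adjoints; taking the range of
    [A] yields the projection. *)
Lemma Riesz_subspace :
  exists2 k, closure K k & forall v, K v -> f v = dot v k.
Proof.
have [k kP] := u_cvg; exists k => [|v Kv].
  apply/closure_rnormP => e /kP[N /(_ N (leqnn N))].
  by exists (u N).
apply/eqP; rewrite eq_sym -subr_eq0; apply/eqP.
apply: ComplexField.Normc.eq0_normc; apply/eqP; rewrite eq_le normc_ge0 andbT.
apply/ler_addgt0Pr => e e0; rewrite add0r.
have v0 : 0 < 1 + nsq v by rewrite ltr_pwDl// -sqr_rnorm sqr_ge0.
(* Half of [e] is spent on [dot v (k - u n)], by Cauchy-Schwarz, and half on [dot v (u n) - f v]. *)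
have d0 : 0 < e / 2 / (1 + rnorm v).
  by rewrite !divr_gt0// ltr_pwDl// rnorm_ge0.
have [N1 N1P] := kP _ d0.
have e4 : 0 < (e / 2) ^+ 2 / (1 + nsq v).
  by rewrite divr_gt0 ?exprn_gt0 ?divr_gt0.
have [N2 _ N2P] := near_infty_natSinv_lt (PosNum e4).
pose n := maxn N1 N2.
have -> : dot v k - f v = dot v (k - u n) + (dot v (u n) - f v).
  by rewrite (pformBr dot_form) addrA subrK.
apply: le_trans (le_normcD _ _) _.
rewrite [leRHS]splitr lerD//.
  apply: le_trans (normc_dot_le _ _) _.
  have := N1P n (leq_maxl _ _); rewrite ltr_pdivlMr; last first.
    by rewrite ltr_pwDl// rnorm_ge0.
  have := rnorm_ge0 v; have := rnorm_ge0 (k - u n); nra.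
rewrite -ler_sqr ?nnegrE ?normc_ge0 ?divr_ge0 ?(ltW e0)//.
apply: le_trans (minimizing_grad (Ku n) Kv) _.
rewrite -ler_pdivlMr//; apply: ltW; apply: lt_trans (Ju n) _.
exact: (N2P n (leq_maxr _ _)).
Qed.

End Minimisation.
End Riesz.

(** * Adjoints, orthogonal projections and the operator [sharp] *)

Section Adjoints.
Context {R : realType} {H : completeNormedModType R[i]}.
Variable dot : {dot H for Num.conj}.
Hypothesis dotP : hilbert_norm dot.

Local Notation nsq := (sqn dot).
Let dotF := dot_form dot.

Lemma linear_adjoint (T S : H -> H) : is_adjoint dot T S -> linear S.
Proof.
move=> TS a x y; apply: (dot_eqr (dot := dot)) => z.
by rewrite (pformDr dotF) (pformZr dotF) -!TS (pformDr dotF) (pformZr dotF).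
Qed.

(** Divide [|S y|^2 = dot (T (S y)) y <= M |S y| |y|] by [|S y|]. *)
Lemma bounded_adjoint (T S : H -> H) :
  bounded_op T -> is_adjoint dot T S -> bounded_op S.
Proof.
move=> /bounded_opP[_ [M M0 TM]] TS; apply/bounded_opP.
split; first exact: linear_adjoint TS.
exists M => // y; have := rnorm_ge0 (S y).
rewrite le_eqVlt => /predU1P[<-|Sy0]; first by rewrite mulr_ge0 ?rnorm_ge0 ?ltW.
rewrite -(ler_pM2r Sy0) -expr2 (sqr_rnorm dotP) /sqn -TS.
apply: le_trans (Re_le_normc _) _; apply: le_trans (normc_dot_le dotP _ _) _.
by rewrite mulrAC ler_wpM2r ?rnorm_ge0.
Qed.

Lemma adjointP (T : H -> H) : bounded_op T -> is_adjoint dot T (adjoint dot T).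
Proof.
move=> Tb; have /bounded_opP[Tl [M M0 TM]] := Tb.
have /choice[S SP] : forall y, exists z, forall x, dot (T x) y = dot x z.
  move=> y; pose f x := dot (T x) y.
  have fP a x z : f (a *: x + z) = a * f x + f z.
    by rewrite /f Tl (pformDl dotF) (pformZl dotF).
  have fM x : normc (f x) <= (M * rnorm y) * rnorm x.
    apply: le_trans (normc_dot_le dotP _ _) _.
    by rewrite mulrAC ler_wpM2r ?rnorm_ge0.
  have [z _ zP] := Riesz_subspace dotP (K := setT) I (fun _ _ _ _ _ => I) fP fM.
  by exists z => x; exact: zP.
have TS : is_adjoint dot T S by move=> x y; exact: SP.
(* [xget] avoids its default value as soon as the set is inhabited, here by [S]. *)
have := @xgetPex _ (cst 0) [set S | bounded_op S /\ is_adjoint dot T S].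
by case=> //; exists S; split=> //; exact: bounded_adjoint TS.
Qed.

Lemma closure_ortho (K : set H) k z :
  closure K k -> (forall v, K v -> dot v z = 0) -> dot k z = 0.
Proof.
move=> /closure_rnormP Kk zK; apply: ComplexField.Normc.eq0_normc.
apply/eqP; rewrite eq_le normc_ge0 andbT; apply/ler_addgt0Pr => e e0.
have z0 : 0 < 1 + rnorm z by rewrite ltr_pwDl// rnorm_ge0.
have [v Kv] := Kk (e / (1 + rnorm z)) (divr_gt0 e0 z0).
rewrite add0r ltr_pdivlMr// => kv.
have -> : dot k z = dot (k - v) z by rewrite (pformBl dotF) (zK v Kv) subr0.
apply: le_trans (normc_dot_le dotP _ _) _.
have := rnorm_ge0 (k - v); move: kv; lra.
Qed.

(** [P x] is the Riesz representative of [dot _ x] on [K]. Linearity and boundedness follow because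
    [P x], lying in the closure of [K], is orthogonal to all that is orthogonal to [K]. *)
Lemma orthogonal_projection (K : set H) : K 0 ->
  (forall a x y, K x -> K y -> K (a *: x + y)) ->
  exists P : H -> H, [/\ bounded_op P, range P `<=` closure K
    & forall x v, K v -> dot v (P x) = dot v x].
Proof.
move=> K0 KP.
have /choice[P PP] : forall x, exists k,
    closure K k /\ forall v, K v -> dot v k = dot v x.
  move=> x; pose f v := dot v x.
  have fP a y z : f (a *: y + z) = a * f y + f z.
    by rewrite /f (pformDl dotF) (pformZl dotF).
  have fM v : normc (f v) <= rnorm x * rnorm v.
    by rewrite mulrC; exact: normc_dot_le.
  have [k Kk kP] := Riesz_subspace dotP K0 KP fP fM.
  by exists k; split=> // v Kv; rewrite -kP.
have PK x z : (forall v, K v -> dot v z = 0) -> dot (P x) z = 0.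
  by apply: closure_ortho; case: (PP x).
exists P; split=> [|_ [x _ <-]|x v Kv]; last 2 first.
- by case: (PP x).
- by case: (PP x) => _ ->.
apply/bounded_opP; split=> [a x y|].
  apply/eqP; rewrite -subr_eq0 -(dnorm_eq0 dot); apply/eqP.
  (* The defect of linearity [z] is orthogonal to [K] and is a combination of values of [P], hence
     orthogonal to itself. *)
  set z := (X in dot X X).
  have zK v : K v -> dot v z = 0.
    move=> Kv; rewrite /z (pformBr dotF) (pformDr dotF) (pformZr dotF).
    by rewrite !(proj2 (PP _))// (pformDr dotF) (pformZr dotF) subrr.
  rewrite {1}/z (pformBl dotF) (pformDl dotF) (pformZl dotF) !PK//.
  by rewrite mulr0 addr0 subr0.
exists 1 => // x; rewrite mul1r; have := rnorm_ge0 (P x).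
rewrite le_eqVlt => /predU1P[<-|Px0]; first exact: rnorm_ge0.
rewrite -(ler_pM2r Px0) -expr2 (sqr_rnorm dotP).
have -> : nsq (P x) = Re (dot (P x) x).
  congr Re; apply/eqP; rewrite -subr_eq0 -(pformBr dotF); apply/eqP/PK => v Kv.
  by rewrite (pformBr dotF) (proj2 (PP _))// subrr.
apply: le_trans (Re_le_normc _) _; apply: le_trans (normc_dot_le dotP _ _) _.
by rewrite mulrC.
Qed.

Variable A : H -> H.
Hypotheses (A_bounded : bounded_op A) (A_pos : positive_op dot A).

(** Polarisation: the form is real at [x], [y], [x + y] and [x + i y]. *)
Lemma positive_selfadjoint : is_adjoint dot A A.
Proof.
have AD x y : A (x + y) = A x + A y.
  by have := A_bounded.1 1 x y; rewrite !scale1r.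
have AZ := scalable_linear A_bounded.1.
move=> x y.
have xx := ger0_Im (A_pos x); have yy := ger0_Im (A_pos y).
have := ger0_Im (A_pos (x + y)).
have := ger0_Im (A_pos (x + 'i%C *: y)).
rewrite !AD !AZ !(pformDl dotF) !(pformDr dotF) !(pformZl dotF) !(pformZr dotF).
have [_ dC _] := dotF; rewrite (dC x (A y)).
move: xx yy; case: (dot (A x) x) => ? ? /=; case: (dot (A y) y) => ? ? /=.
case: (dot (A x) y) => a b; case: (dot (A y) x) => c d /= -> -> h1 h2.
congr Complex; lra.
Qed.

Lemma dotA_form : positive_form (dotA dot A).
Proof.
have [_ dC _] := dotF; split=> [a x y z|x y|x]; last exact: A_pos.
  by rewrite /dotA A_bounded.1 (pformDl dotF) (pformZl dotF).
by rewrite /dotA positive_selfadjoint dC.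
Qed.

Lemma sharpP (T : H -> H) : BA dot A T -> is_sharp dot A T (sharp dot A T).
Proof.
move=> [Tb [S [Sb AS]]].
have A0 : A 0 = 0.
  by have /= := scalable_linear A_bounded.1 0 0; rewrite !scale0r.
have [||P [Pb PA PP]] := orthogonal_projection (K := range A).
- by exists 0.
- move=> a _ _ [x _ <-] [y _ <-]; exists (a *: x + y) => //.
  by rewrite A_bounded.1.
(* Against [z] this reads [dot (A z) (P x) = dot (A z) x], which holds as [A z] is in the range of
   [A]. *)
have AP x : A (P x) = A x.
  apply: (dot_eqr (dot := dot)) => z; rewrite -!positive_selfadjoint.
  by apply: PP; exists z.
apply: (@xgetPex _ (cst 0) [set X | is_sharp dot A T X]); exists (P \o S).
split; first exact: bounded_op_comp.
- by rewrite -AS; apply/funext => x /=; rewrite AP.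
- by move=> _ [x _ <-]; apply: PA; exists (S x).
Qed.

Lemma dotA_sharp (T : H -> H) x y : BA dot A T ->
  dotA dot A (T x) y = dotA dot A x (sharp dot A T y).
Proof.
move=> TA; have [_ /(congr1 (@^~ y))/= AX _] := sharpP TA.
by rewrite /dotA !positive_selfadjoint AX -adjointP//; case: TA.
Qed.

End Adjoints.

(* A log-convex sequence with [q 0 = 1] dominates the powers of [q 1]. *)
Lemma log_convex_growth {R : realType} (q : nat -> R) (c M : R) :
  (forall n, 0 <= q n) -> q 0 = 1 -> (forall n, q n.+1 ^+ 2 <= q n * q n.+2) ->
  0 < M -> (forall n, q n <= c * M ^+ n) -> q 1 <= M.
Proof.
move=> q_ge0 q0 q_convex M0 qM; rewrite leNgt; apply/negP => Mq.
have q1_gt0 : 0 < q 1 by exact: lt_trans Mq.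
(* The ratios of consecutive terms never fall below [q 1]; positivity is carried along to allow
   cancelling. *)
have q_step n : 0 < q n /\ q 1 * q n <= q n.+1.
  elim: n => [|n [qn_gt0 qn_le]]; first by rewrite q0 mulr1.
  have qSn_gt0 : 0 < q n.+1 by apply: lt_le_trans qn_le; exact: mulr_gt0.
  split=> //; rewrite -(ler_pM2l qn_gt0); apply: le_trans (q_convex n).
  by rewrite mulrA (mulrC (q n)) expr2 ler_pM2r.
have q_pow n : q 1 ^+ n <= q n.
  elim: n => [|n IHn]; first by rewrite q0.
  by apply: le_trans (q_step n).2; rewrite exprS ler_pM2l.
(* Growth would force [(1 + h) ^+ n <= c] for all [n], against Bernoulli's inequality. *)
pose h := q 1 / M - 1.
have h_gt0 : 0 < h by rewrite subr_gt0 ltr_pdivlMr ?mul1r.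
have ch n : n%:R * h <= c.
  apply: (@le_trans _ _ ((1 + h) ^+ n)).
    elim: n => [|n IHn]; first by rewrite mul0r expr0.
    have := mulr_ge0 (ler0n R n) (ltW h_gt0).
    have : 1 <= (1 + h) ^+ n by rewrite exprn_ege1// lerDl ltW.
    by rewrite exprS -natr1; nra.
  rewrite /h addrC subrK expr_div_n ler_pdivrMr ?exprn_gt0//.
  exact: le_trans (q_pow n) (qM n).
have [n] : exists n : nat, c / h < n%:R.
  by exists (Num.truncn (c / h)).+1; exact: truncnS_gt.
by rewrite ltr_pdivrMr// ltNge ch.
Qed.

(** * Bounds through the A-Euclidean operator radius *)

Section EuclideanRadius.
Context {R : realType} {H : completeNormedModType R[i]}.
Variable dot : {dot H for Num.conj}.
Hypothesis dotP : hilbert_norm dot.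
Variable A : H -> H.
Hypotheses (A_bounded : bounded_op A) (A_pos : positive_op dot A).

Local Notation dA := (dotA dot A).
Local Notation nsqA := (sqn (dotA dot A)).
Let dAF : positive_form dA := dotA_form A_bounded A_pos.

Lemma sqr_normA x : normA dot A x ^+ 2 = nsqA x.
Proof. by rewrite sqr_sqrtr// (sqn_ge0 dAF). Qed.

Definition A_adjoint (S T : H -> H) := forall x y, dA (S x) y = dA x (T y).

Lemma A_adjointC S T : A_adjoint S T -> A_adjoint T S.
Proof. by have [_ dC _] := dAF; move=> ST x y; rewrite dC -ST -dC. Qed.

(** Log-convexity is Cauchy-Schwarz for [T^n x] and [T^(n+2) x], one [T] being moved across. The
    factor [K * rnorm x ^+ 2] depends on [x], but the resulting bound [M ^+ 2] does not. *)
Lemma sqnA_selfadjoint_le (T : H -> H) : bounded_op T -> A_adjoint T T ->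
  exists M, forall x, nsqA x = 1 -> nsqA (T x) <= M.
Proof.
move=> /bounded_opP[_ [M M0 TM]] TT; exists (M ^+ 2) => x x1.
have /bounded_opP[_ [K K0 AK]] := A_bounded.
apply: (@log_convex_growth _ (fun n => nsqA (iter n T x)) (K * rnorm x ^+ 2)).
- by move=> n; exact: sqn_ge0 dAF _.
- by [].
- move=> n; apply: le_trans (form_CauchySchwarz dAF _ _).
  by rewrite /= -TT normc_ge0_id//; exact: A_pos.
- exact: exprn_gt0.
move=> n; apply: le_trans (Re_le_normc _) _.
apply: le_trans (normc_dot_le dotP _ _) _.
have TnM : rnorm (iter n T x) <= M ^+ n * rnorm x.
  elim: n => [|n IHn]; first by rewrite mul1r.
  by apply: le_trans (TM _) _; rewrite exprS -mulrA ler_pM2l.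
apply: (@le_trans _ _ (K * rnorm (iter n T x) ^+ 2)).
  by rewrite expr2 mulrA ler_wpM2r ?rnorm_ge0.
rewrite -mulrA ler_pM2l// exprAC mulrC -exprMn.
by rewrite ler_sqr ?nnegrE ?rnorm_ge0// mulr_ge0 ?rnorm_ge0// exprn_ge0// ltW.
Qed.

Lemma normc_selfadjoint_le (T : H -> H) : bounded_op T -> A_adjoint T T ->
  exists M, forall x, nsqA x = 1 -> normc (dA (T x) x) ^+ 2 <= M.
Proof.
move=> Tb /(sqnA_selfadjoint_le Tb)[M TM]; exists M => x x1.
by apply: le_trans (form_CauchySchwarz dAF _ _) _; rewrite x1 mulr1 TM.
Qed.

(** [sup] dominates only sets that are bounded above; [normc_selfadjoint_le] provides that bound. *)
Lemma wAe_ubound (S T : H -> H) x :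
  bounded_op S -> A_adjoint S S -> bounded_op T -> A_adjoint T T ->
  normA dot A x = 1 ->
  Num.sqrt (normc (dA (S x) x) ^+ 2 + normc (dA (T x) x) ^+ 2)
    <= wAe dot A S T.
Proof.
move=> Sb SS Tb TT x1; apply: ub_le_sup; last by exists x.
have [M SM] := normc_selfadjoint_le Sb SS.
have [N TN] := normc_selfadjoint_le Tb TT.
exists (Num.sqrt (M + N)) => _ [y y1 <-]; apply: ler_wsqrtr.
have y1' : nsqA y = 1 by rewrite -sqr_normA y1 expr1n.
by rewrite lerD ?SM ?TN.
Qed.

Section AdjointPairs.
Variables B B' C C' : H -> H.
Hypotheses (Bb : bounded_op B) (Bb' : bounded_op B').
Hypotheses (Cb : bounded_op C) (Cb' : bounded_op C').
Hypotheses (BB' : A_adjoint B B') (CC' : A_adjoint C C').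

(** Arbitrary adjoint pairs let one argument serve twice: for [B] with its [sharp], and with the two
    exchanged. *)
Let w := wAe dot A (B' \o B) (C' \o C).

Lemma wAe_sqn_le x : normA dot A x = 1 ->
  Num.sqrt (nsqA (B x) ^+ 2 + nsqA (C x) ^+ 2) <= w.
Proof.
have comp_self S S' : A_adjoint S S' -> A_adjoint (S' \o S) (S' \o S).
  by move=> SS' y z /=; rewrite (A_adjointC SS') SS'.
have sqn_comp S S' : A_adjoint S S' -> nsqA (S x) = normc (dA (S' (S x)) x).
  by move=> SS'; rewrite (A_adjointC SS') normc_ge0_id//; exact: A_pos.
move=> x1; rewrite (sqn_comp _ _ BB') (sqn_comp _ _ CC').
apply: (@wAe_ubound (B' \o B) (C' \o C)) => //.
- exact: bounded_op_comp.
- exact: comp_self.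
- exact: bounded_op_comp.
- exact: comp_self.
Qed.

(** The 8 is [2 ^+ 2] from [sqnD_le] times the 2 of [(b + c)^2 <= 2 (b^2 + c^2)]. *)
Lemma sqn_add_le x : normA dot A x = 1 -> nsqA (B x + C x) ^+ 2 <= 8 * w ^+ 2.
Proof.
move=> x1; have := wAe_sqn_le x1.
have := sqnD_le dAF (B x) (C x).
have := sqn_ge0 dAF (B x + C x).
set b := nsqA (B x); set c := nsqA (C x); set n := nsqA _ => n0 nbc bcw.
have w0 : 0 <= w by exact: le_trans bcw.
have bc0 : 0 <= b ^+ 2 + c ^+ 2 by rewrite addr_ge0 ?sqr_ge0.
have bcw2 : b ^+ 2 + c ^+ 2 <= w ^+ 2.
  by rewrite -[leLHS](sqr_sqrtr bc0) ler_sqr ?nnegrE ?sqrtr_ge0.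
have := sqr_ge0 (b - c); nra.
Qed.

End AdjointPairs.

(** Put [z = B x + C x]. Then [nsqA z = dA x (B' z + C' z)], so Cauchy-Schwarz gives
    [nsqA z ^+ 2 <= nsqA (B' z + C' z)]; [y] is [z] normalised. *)
Lemma sqn_add_adjoint_le (B B' C C' : H -> H) x :
  linear B' -> linear C' -> A_adjoint B B' -> A_adjoint C C' ->
  normA dot A x = 1 -> 0 < nsqA (B x + C x) ->
  exists2 y, normA dot A y = 1 &
    nsqA (B x + C x) <= nsqA (B' y + C' y).
Proof.
move=> B'l C'l BB' CC' x1; set z := B x + C x => z0.
pose s := (Num.sqrt (nsqA z))^-1.
have s2 : s ^+ 2 = (nsqA z)^-1 by rewrite exprVn sqr_sqrtr// ltW.
exists (s%:C%C *: z).
  rewrite /normA -/(nsqA _) (sqnZr dAF) s2 mulVf ?sqrtr1//.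
  exact: lt0r_neq0.
rewrite (scalable_linear B'l) (scalable_linear C'l) -scalerDr (sqnZr dAF) s2.
rewrite mulrC ler_pdivlMr//.
have zE : dA x (B' z + C' z) = dA z z.
  by rewrite (pformDr dAF) -BB' -CC' -(pformDl dAF).
have := form_CauchySchwarz dAF x (B' z + C' z).
rewrite zE normc_ge0_id; last exact: A_pos.
by rewrite -sqr_normA x1 expr1n mul1r expr2.
Qed.

End EuclideanRadius.

Theorem theorem2p12 (R : realType) (H : completeNormedModType R[i])
    (dot : {dot H for Num.conj}) (dotP : hilbert_norm dot)
    (A : H -> H) (A_bounded : bounded_op A) (A_pos : positive_op dot A)
    (A_neq0 : A <> cst 0)
    (B C : H -> H) (BAB : BA dot A B) (BAC : BA dot A C) :
  8^-1 * opnormA dot A (B \+ C) ^+ 4 <=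
    wAe dot A (sharp dot A B \o B) (sharp dot A C \o C) *
    wAe dot A (B \o sharp dot A B) (C \o sharp dot A C).
Proof.
have dAF := dotA_form A_bounded A_pos.
have [Bb _] := BAB; have [Cb _] := BAC.
set B' := sharp dot A B; set C' := sharp dot A C.
have [Bb' _ _] : is_sharp dot A B B' by exact: sharpP.
have [Cb' _ _] : is_sharp dot A C C' by exact: sharpP.
have BB' : A_adjoint dot A B B' by move=> x y; exact: dotA_sharp.
have CC' : A_adjoint dot A C C' by move=> x y; exact: dotA_sharp.
set w1 := wAe _ _ _ _; set w2 := wAe _ _ _ _.
have [[x0 x01]|no_unit] := pselect (exists x, normA dot A x = 1); last first.
  (* All three suprema are then over the empty set, where [sup] is 0. *)
  have unit0 : [set x | normA dot A x = 1] = set0.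
    by rewrite -subset0 => x x1; apply: no_unit; exists x.
  by rewrite /w1 /w2 /opnormA /wAe unit0 !image_set0 sup0 expr0n !mulr0.
have B'B := A_adjointC A_bounded A_pos BB'.
have C'C := A_adjointC A_bounded A_pos CC'.
have w1_ge0 : 0 <= w1.
  apply: le_trans; last exact: (wAe_sqn_le dotP _ _ Bb _ Cb _ BB' CC' x01).
  exact: sqrtr_ge0.
have w2_ge0 : 0 <= w2.
  apply: le_trans; last exact: (wAe_sqn_le dotP _ _ Bb' _ Cb' _ B'B C'C x01).
  exact: sqrtr_ge0.
have sqn_le x : normA dot A x = 1 ->
    sqn (dotA dot A) (B x + C x) ^+ 2 <= 8 * (w1 * w2).
  move=> x1; have := sqn_ge0 dAF (B x + C x).
  rewrite le_eqVlt => /predU1P[<-|n_gt0].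
    by rewrite expr0n !mulr_ge0.
  have n_le1 := sqn_add_le dotP A_bounded A_pos Bb Bb' Cb Cb' BB' CC' x1.
  have [y y1 n_ley] :=
    sqn_add_adjoint_le A_bounded A_pos Bb'.1 Cb'.1 BB' CC' x1 n_gt0.
  have y_le2 := sqn_add_le dotP A_bounded A_pos Bb' Bb Cb' Cb B'B C'C y1.
  have n_le2 : sqn (dotA dot A) (B x + C x) ^+ 2 <= 8 * w2 ^+ 2.
    by apply: le_trans y_le2; rewrite ler_sqr// nnegrE (sqn_ge0 dAF).
  (* After squaring, the goal is the product of [n_le1] and [n_le2]. *)
  rewrite -ler_sqr ?nnegrE ?sqr_ge0 ?mulr_ge0//.
  rewrite [leRHS](_ : _ = (8 * w1 ^+ 2) * (8 * w2 ^+ 2)); last by ring.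
  by rewrite expr2 ler_pM ?sqr_ge0.
have norm_le x : normA dot A x = 1 ->
    normA dot A ((B \+ C) x) <= Num.sqrt (Num.sqrt (8 * (w1 * w2))).
  move=> x1; apply: ler_wsqrtr.
  by rewrite -[leLHS]ger0_norm ?(sqn_ge0 dAF)// -sqrtr_sqr ler_wsqrtr// sqn_le.
have op_le : opnormA dot A (B \+ C) <= Num.sqrt (Num.sqrt (8 * (w1 * w2))).
  apply: ge_sup; first by exists (normA dot A ((B \+ C) x0)), x0.
  by move=> _ [x x1 <-]; exact: norm_le.
(* Needed to take fourth powers of [op_le]; again the supremum dominates its elements because
   [norm_le] bounds them. *)
have op_ge0 : 0 <= opnormA dot A (B \+ C).
  apply: (@le_trans _ _ (normA dot A ((B \+ C) x0))); first exact: sqrtr_ge0.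
  apply: ub_le_sup; last by exists x0.
  exists (Num.sqrt (Num.sqrt (8 * (w1 * w2)))) => _ [x x1 <-].
  exact: norm_le.
rewrite mulrC ler_pdivrMr// mulrC.
have := lerXn2r 4 op_ge0 (sqrtr_ge0 _) op_le.
by rewrite -[4%N]/(2 * 2)%N !exprM !sqr_sqrtr ?sqrtr_ge0 ?mulr_ge0.
Qed.
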